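(* Consider the $n$-run scheme with $n\ge 1$ independent non-empty GS trials. Then, with the supremum over all Borel sets $A\subseteq\mathbb{R}^d$, \[ \sup_{A}\bigl|\mathbb{Q}_n(A)-\mathbb{Q}(A)\bigr|\le \frac{c_1}{n},\qquad c_1:=\frac{\operatorname{Var}(M)+\sqrt{\operatorname{Var}(M)\,\mathbb{E}[M^2]}}{m^{2}}, \] and \[ \sup_{A}\mathbb{E}\bigl|\widehat{\mathbb{Q}}_n(A)-\mathbb{Q}(A)\bigr|\le \frac{\tilde c_1(n)}{\sqrt n},\qquad \tilde c_1(n):=\frac{\sqrt{\mathbb{E}[M^2]}+\sqrt{3\,\mathbb{E}[M^4]/n}}{m}, \] where $\tilde c_1(n)$ is bounded uniformly in $n$.
   Context: Standing setup (generalized splitting, GS). Let $f$ be a probability density on $\mathbb{R}^d$, let $S:\mathbb{R}^d\to\mathbb{R}$ be measurable, and let $\gamma\in\mathbb{R}$ be such that $\mathbb{P}(S(\mathbf{X})\ge\gamma)>0$ for $\mathbf{X}\sim f$. Fix an integer splitting factor $s\ge 2$, an integer $\tau\ge 1$ and levels $-\infty=\gamma_0<\gamma_1<\dots<\gamma_\tau=\gamma$. For each $l=0,\dots,\tau$ let $\kappa_l(\mathrm{d}\mathbf{y}\mid\mathbf{x})$ be a Markov transition kernel on $\mathbb{R}^d$ whose stationary distribution has density $q_l(\mathbf{y})=f(\mathbf{y})\mathbb{I}\{S(\mathbf{y})\ge\gamma_l\}/\mathbb{P}(S(\mathbf{X})\ge\gamma_l)$. One GS trial is: generate $\mathbf{Y}\sim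 f$; if $S(\mathbf{Y})<\gamma_1$, return the empty multiset. Otherwise set $\mathcal{X}_1=\{\mathbf{Y}\}$ and for $l=2,\dots,\tau$: set $\mathcal{X}_l=\emptyset$, and for every $\mathbf{Y}\in\mathcal{X}_{l-1}$ put $\mathbf{Y}_0=\mathbf{Y}$ and for $j=1,\dots,s$ sample $\mathbf{Y}_j\sim\kappa_{l-1}(\cdot\mid\mathbf{Y}_{j-1})$ (with fresh independent randomness) and add $\mathbf{Y}_j$ to $\mathcal{X}_l$ if $S(\mathbf{Y}_j)\ge\gamma_l$. The trial returns the multiset $\mathcal{X}_\tau$. A non-empty trial repeats independent GS trials until the returned multiset is non-empty and outputs that multiset $\mathcal{Y}$. Let $M=|\mathcal{Y}|$ (counted with multiplicity), so $1\le M\le s^{\tau-1}$, and for measurable $A$ let $H(A)=|\mathcal{Y}\cap A|$ be the number of elements of $\mathcal{Y}$ (with multiplicity) lying in $A$. Write $m=\mathbb{E}[M]$ and $\operatorname{Var}(M)$ for the variance of $M$. The target distribution is $\mathbb{Q}(A)=\mathbb{P}(\mathbf{X}\in A\mid S(\mathbf{X})\ge\gamma)$, $\mathbf{X}\sim f$. Let $\mathcal{Y}_1,\mathcal{Y}_2,\dots$ be independent non-empty trials with corresponding $M_i$ and $H_i(A)$. $n$-run scheme: $\widehat{\mathbb{Q}}_n(A)=\sum_{i=1}^n H_i(A)\big/\sum_{i=1}^n M_i$ (the empirical distribution of the pooled multiset $\mathcal{Y}_1\cup\dots\cup\mathcal{Y}_n$), and $\mathbb{Q}_n(A)=\mathbb{E}[\widehat{\mathbb{Q}}_n(A)]$.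 *)

(* Defs.v *)
From HB Require Import structures.
From mathcomp Require Import all_boot all_order all_algebra.
From mathcomp Require Import all_classical all_reals all_analysis.
Set Implicit Arguments. Unset Strict Implicit. Unset Printing Implicit Defensive.
Import Order.TTheory GRing.Theory Num.Theory.
Local Open Scope classical_set_scope.
Local Open Scope ring_scope.

(* R^d is represented by d.-tuple R, with the product (= Borel) sigma-algebra
   generated by the coordinates. *)

(* Lebesgue integral over R^d of a nonnegative function, as an iterated
   integral (Tonelli): int g(x_1,...,x_d) dx_1 ... dx_d. *)
Fixpoint iint {R : realType} (n : nat) : (n.-tuple R -> \bar R) -> \bar R :=
  match n with
  | 0 => fun g => g [tuple]
  | n'.+1 => fun g =>
      (\int[@lebesgue_measure R]_x iint (fun t => g (cons_tuple x t)))%E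
  end.

Section GS.
Context {R : realType} {d : nat}.
Local Notation E := (d.-tuple R).
(* f : density, S : score, g : levels (g 0 = -oo), s : splitting factor,
   tau : number of levels, kappa l : Markov kernel kappa_l *)
Variables (f S : E -> R) (g : nat -> \bar R) (s tau : nat)
  (kappa : nat -> R.-pker E ~> E).

Definition above (l : nat) (x : E) : bool := (g l <= (S x)%:E)%E.

Definition Zl (l : nat) : R :=
  fine (iint (fun x => ((f x) * (above l x)%:R)%:E)).
Definition qdens (l : nat) (x : E) : R := f x * (above l x)%:R / Zl l.

Definition stationary (l : nat) : Prop :=
  forall B : set E, measurable B ->
    iint (fun x => ((qdens l x)%:E * kappa l x B)%E) =
    iint (fun x => (qdens l x * \1_B x)%:E).

(* Expectations of functionals K of the random multiset produced by the
   algorithm, written in continuation-passing style: each [\int[kappa l y]_z]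
   is the sampling step Y_j ~ kappa_l(. | Y_{j-1}) with fresh randomness. *)

Fixpoint chain (l j : nat) (y : E) (acc : seq E) (K : seq E -> \bar R)
  : \bar R :=
  match j with
  | 0 => K acc
  | j'.+1 => (\int[kappa l y]_z
               chain l j' z (if above l.+1 z then z :: acc else acc) K)%E
  end.

Fixpoint step (l : nat) (xs acc : seq E) (K : seq E -> \bar R) : \bar R :=
  match xs with
  | [::] => K acc
  | x :: xs' => chain l s x acc (fun acc' => step l xs' acc' K)
  end.

Fixpoint run (k l : nat) (xs : seq E) (K : seq E -> \bar R) : \bar R :=
  match k with
  | 0 => K xs
  | k'.+1 => step l xs [::] (fun ys => run k' l.+1 ys K)
  end.

Definition trialE (K : seq E -> \bar R) : \bar R :=
  iint (fun y => ((f y)%:E *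
    (if above 1 y then run (tau - 1) 1 [:: y] K else K [::]))%E).

(* E[K(Y)] for a non-empty trial (law of the first non-empty output among
   repeated independent trials = trial law conditioned on non-emptiness) *)
Definition neE (K : seq E -> \bar R) : R :=
  fine (trialE (fun ys => if ys is [::] then 0%E else K ys)) /
  fine (trialE (fun ys => if ys is [::] then 0%E else 1%E)).

Fixpoint multiE (n : nat) (K : seq (seq E) -> \bar R) : R :=
  match n with
  | 0 => fine (K [::])
  | n'.+1 => neE (fun Y => (multiE n' (fun Ys => K (Y :: Ys)))%:E)
  end.

Definition Mcount (Y : seq E) : nat := size Y.
Definition Hcount (A : set E) (Y : seq E) : nat := count (fun x => `[< A x >]) Y.

Definition Qhat (Ys : seq (seq E)) (A : set E) : R :=
  (\sum_(Y <- Ys) Hcount A Y)%:R / (\sum_(Y <- Ys) Mcount Y)%:R.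

Definition Qn (n : nat) (A : set E) : R := multiE n (fun Ys => (Qhat Ys A)%:E).

Definition momM (k : nat) : R := neE (fun Y => ((Mcount Y)%:R ^+ k)%:E).
Definition mM : R := momM 1.
Definition VarM : R := momM 2 - mM ^+ 2.

End GS.

Definition Qtarget {R : realType} {d : nat} (f S : d.-tuple R -> R) (gam : R)
  (A : set (d.-tuple R)) : R :=
  fine (iint (fun x => (f x * \1_(A `&` [set y | gam <= S y]) x)%:E)) /
  fine (iint (fun x => (f x * \1_[set y | gam <= S y] x)%:E)).

(* Main.v *)
Require Import Defs.
From HB Require Import structures.
From mathcomp Require Import all_boot all_order all_algebra.
From mathcomp Require Import all_classical all_reals all_analysis.
From mathcomp Require Import measurable_realfun ring lra.
Import Order.TTheory GRing.Theory Num.Theory.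
Local Open Scope classical_set_scope.
Local Open Scope ring_scope.

(* Stationarity of kappa_l makes the expected number of elements of a trial
   lying in A equal to s^(tau-1) P(X in A, S(X) >= gam); hence for a non-empty
   trial E[H(A)] = q E[M] with q = Q(A).  Only the pair (M, H(A)) matters, and
   it takes finitely many values, so the rest is an estimate for a ratio of sums
   of n i.i.d. pairs.  Put D = H - qM, which is centred with |D| <= M, let a bar
   denote averages over the n trials, and use

     Qhat - q = Dbar / m + (Qhat - q) (m - Mbar) / m.

   Applying this identity twice bounds the bias: the term linear in Dbar has
   mean zero, Dbar (m - Mbar) is controlled by Cauchy-Schwarz, and |Qhat - q| <= 1
   in the last term.  Applying it once, with |Qhat - q| <= |Dbar| because
   Mbar >= 1, bounds the L1 error. *)

Set Implicit Arguments.
Unset Strict Implicit.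

(** * Iterated integrals *)

(** Two features of the setting shape the proof. Integration over R^d is given as an iterated
    integral, not as integration against a measure on R^d, so additivity, homogeneity and monotone
    convergence are established coordinate by coordinate; these three properties suffice to pass
    from stationarity on sets to stationarity for nonnegative functions. Expectations over a trial
    are in continuation-passing form, over lists of random length. Measurability is tracked on each
    length separately, and only nonnegative continuations are integrated until everything has become
    a finite sum. That reduction also controls the [fine] inside [neE] and [multiE], under which an
    infinite value would silently become 0. The dependence between the states of one chain never has
    to be described: a trial enters the estimates only through the expected sums and the pointwise
    bounds 1 <= M and 0 <= H <= M. *)

Section iint_theory.
Context {R : realType}.
Local Open Scope ereal_scope.

Lemma iint_ge0 n (h : n.-tuple R -> \bar R) : (forall x, 0 <= h x) -> 0 <= iint h.
Proof.
elim: n h => [|n IHn] h h0 /=; first exact: h0.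
by apply: integral_ge0 => x _; apply: IHn.
Qed.

(** The parameter space is arbitrary because the induction moves the first coordinate into it: the
    inner iterated integral is measurable on [T * R], and Tonelli keeps measurability when that
    coordinate is integrated out. *)
Lemma measurable_iint {d} {T : measurableType d} (n : nat)
    (G : T * n.-tuple R -> \bar R) :
  measurable_fun [set: T * n.-tuple R] G -> (forall p, 0 <= G p) ->
  measurable_fun [set: T] (fun t => iint (fun x => G (t, x))).
Proof.
elim: n d T G => [|n IH] d T G mG G0 /=.
  by apply: (measurableT_comp mG); apply: measurable_fun_pair.
have mH : measurable_fun [set: T * R]
    (fun p : T * R => iint (fun x : n.-tuple R => G (p.1, cons_tuple p.2 x))).
  apply: (IH _ _ (fun q : (T * R) * n.-tuple R => G (q.1.1, cons_tuple q.1.2 q.2))) => //.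
  apply: (measurableT_comp mG); apply: measurable_fun_pair.
    by apply: (measurableT_comp measurable_fst).
  apply: measurable_cons => //.
  by apply: (measurableT_comp measurable_snd).
apply: (@measurable_fun_fubini_tonelli_F _ _ _ _ _ (@lebesgue_measure R)
  (fun p : T * R => iint (fun x : n.-tuple R => G (p.1, cons_tuple p.2 x)))) => //.
by move=> p; apply: iint_ge0.
Qed.

Lemma measurable_fun_cons_tuple n (h : n.+1.-tuple R -> \bar R) (x : R) :
  measurable_fun [set: n.+1.-tuple R] h ->
  measurable_fun [set: n.-tuple R] (fun t => h (cons_tuple x t)).
Proof.
by move=> mh; apply: (measurableT_comp mh); apply: measurable_cons.
Qed.

Lemma measurable_iint_cons n (h : n.+1.-tuple R -> \bar R) :
  measurable_fun [set: n.+1.-tuple R] h -> (forall x, 0 <= h x) ->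
  measurable_fun [set: R] (fun x => iint (fun t => h (cons_tuple x t))).
Proof.
move=> mh h0.
apply: (@measurable_iint _ _ n (fun p : R * n.-tuple R => h (cons_tuple p.1 p.2))) => //.
by apply: (measurableT_comp mh); apply: measurable_cons.
Qed.

Lemma iintD n (h1 h2 : n.-tuple R -> \bar R) :
  measurable_fun [set: n.-tuple R] h1 -> (forall x, 0 <= h1 x) ->
  measurable_fun [set: n.-tuple R] h2 -> (forall x, 0 <= h2 x) ->
  iint (fun x => h1 x + h2 x) = iint h1 + iint h2.
Proof.
elim: n h1 h2 => [//|n IHn] h1 h2 m1 p1 m2 p2 /=.
rewrite -ge0_integralD //=; try by [move=> *; apply: iint_ge0|apply: measurable_iint_cons].
by apply: eq_integral => x _; apply: IHn => //; apply: measurable_fun_cons_tuple.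
Qed.

Lemma iintZl n (k : R) (h : n.-tuple R -> \bar R) :
  measurable_fun [set: n.-tuple R] h -> (forall x, 0 <= h x) -> (0 <= k)%R ->
  iint (fun x => k%:E * h x) = k%:E * iint h.
Proof.
elim: n h => [//|n IHn] h mh h0 k0 /=.
rewrite -ge0_integralZl //=; try by [move=> *; apply: iint_ge0|apply: measurable_iint_cons].
by apply: eq_integral => x _; apply: IHn => //; apply: measurable_fun_cons_tuple.
Qed.

Lemma le_iint n (h1 h2 : n.-tuple R -> \bar R) :
  measurable_fun [set: n.-tuple R] h1 -> (forall x, 0 <= h1 x) ->
  measurable_fun [set: n.-tuple R] h2 -> (forall x, h1 x <= h2 x) -> iint h1 <= iint h2.
Proof.
elim: n h1 h2 => [|n IHn] h1 h2 m1 p1 m2 le12 /=; first exact: le12.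
have p2 x : 0 <= h2 x by exact: le_trans (le12 x).
apply: ge0_le_integral => //; try by [move=> *; apply: iint_ge0|apply: measurable_iint_cons].
by move=> x _; apply: IHn => //; apply: measurable_fun_cons_tuple.
Qed.

Lemma iint_monotone_convergence n (h : (n.-tuple R -> \bar R)^nat) :
  (forall k, measurable_fun [set: n.-tuple R] (h k)) -> (forall k x, 0 <= h k x) ->
  (forall x, nondecreasing_seq (h ^~ x)) ->
  iint (fun x => limn (h ^~ x)) = limn (fun k => iint (h k)).
Proof.
elim: n h => [//|n IHn] h mh h0 nh /=.
rewrite -monotone_convergence //=.
- apply: eq_integral => x _.
  by apply: (IHn (fun k t => h k (cons_tuple x t))) => // k; apply: measurable_fun_cons_tuple.
- by move=> k; apply: measurable_iint_cons.
- by move=> k x _; apply: iint_ge0.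
- move=> x _ k l kl; apply: le_iint => //; try exact: measurable_fun_cons_tuple.
  by move=> t; apply: nh.
Qed.

End iint_theory.

(** * Integral-like functionals and their determination by indicators *)

Section ge0_functional.
Context {d} {T : measurableType d} {R : realType}.
Local Open Scope ereal_scope.
Import HBNNSimple.

(** These properties hold for a weighted iterated integral and survive composition with a kernel, so
    both sides of the stationarity equation are instances. *)
Record ge0_functional (I : (T -> \bar R) -> \bar R) := {
  functionalD : forall h1 h2, measurable_fun [set: T] h1 -> (forall x, 0 <= h1 x) ->
    measurable_fun [set: T] h2 -> (forall x, 0 <= h2 x) ->
    I (fun x => h1 x + h2 x) = I h1 + I h2 ;
  functionalZl : forall (k : R) h, measurable_fun [set: T] h -> (forall x, 0 <= h x) ->
    (0 <= k)%R -> I (fun x => k%:E * h x) = k%:E * I h ;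
  functional_lim : forall h : (T -> \bar R)^nat,
    (forall k, measurable_fun [set: T] (h k)) -> (forall k x, 0 <= h k x) ->
    (forall x, nondecreasing_seq (h ^~ x)) ->
    I (fun x => limn (h ^~ x)) = limn (fun k => I (h k)) }.

Lemma functional0 I : ge0_functional I -> I (fun=> 0) = 0.
Proof.
move=> HI; rewrite -[RHS](mul0e (I (fun=> 0))).
rewrite -(functionalZl HI) //.
by congr I; apply/funext => x; rewrite mul0e.
Qed.

Lemma functional_sum I (J : Type) (r : seq J) (h : J -> T -> \bar R) :
  ge0_functional I ->
  (forall j, measurable_fun [set: T] (h j)) -> (forall j x, 0 <= h j x) ->
  I (fun x => \sum_(j <- r) h j x) = \sum_(j <- r) I (h j).
Proof.
move=> HI mh h0; elim: r => [|j r IHr].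
  rewrite big_nil -[RHS](functional0 HI); congr I.
  by apply/funext => x; rewrite big_nil.
rewrite big_cons -IHr -(functionalD HI) //.
- by congr I; apply/funext => x; rewrite big_cons.
- exact: emeasurable_sum.
- by move=> x; apply: sume_ge0.
Qed.

Lemma functional_unique I1 I2 : ge0_functional I1 -> ge0_functional I2 ->
  (forall A, measurable A -> I1 (EFin \o \1_A) = I2 (EFin \o \1_A)) ->
  forall h, measurable_fun [set: T] h -> (forall x, 0 <= h x) -> I1 h = I2 h.
Proof.
move=> H1 H2 H12 h mh h0.
pose h_ := nnsfun_approx measurableT mh.
have hE : h = fun x => limn (fun k => (h_ k x)%:E).
  apply/funext => x; apply/esym/cvg_lim => //.
  exact: (cvg_nnsfun_approx measurableT mh (fun x _ => h0 x)).
have simple k : I1 (fun x => (h_ k x)%:E) = I2 (fun x => (h_ k x)%:E).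
  pose t (r : R) x := (r * \1_(h_ k @^-1` [set r]) x)%:E.
  have mt r : measurable_fun [set: T] (t r) by exact/measurable_EFinP/measurableT_comp.
  have t0 r x : 0 <= t r x by rewrite /t EFinM nnfun_muleindic_ge0.
  have -> : (fun x => (h_ k x)%:E) =
      fun x => \sum_(r <- finmap.enum_fset (fset_set (range (h_ k)))) t r x.
    apply/funext => x; rewrite fimfunE -fsumEFin//.
    by rewrite fsbig_finite.
  rewrite !functional_sum//; apply: eq_bigr => r _.
  (* Homogeneity covers only nonnegative factors. A negative r is not a value of the nonnegative
     function [h_ k], so its level set is empty and the term vanishes. *)
  have [r0|r0] := leP 0%R r.
    rewrite (_ : t r = fun x => r%:E * (EFin \o \1_(h_ k @^-1` [set r])) x); last first.
      by apply/funext => x; rewrite /t EFinM.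
    rewrite !functionalZl//; last 4 first.
    - exact/measurable_EFinP.
    - by move=> x; rewrite lee_fin.
    - exact/measurable_EFinP.
    - by move=> x; rewrite lee_fin.
    by rewrite H12.
  rewrite (_ : t r = fun=> 0) ?functional0//.
  by apply/funext => x; rewrite /t preimage_nnfun0// indic0 mulr0.
rewrite hE !(functional_lim H1) ?(functional_lim H2); last first.
- by move=> x a b ab; rewrite lee_fin; apply/lefP/nd_nnsfun_approx.
- by move=> k x; rewrite lee_fin.
- by move=> k; apply/measurable_EFinP.
- by move=> x a b ab; rewrite lee_fin; apply/lefP/nd_nnsfun_approx.
- by move=> k x; rewrite lee_fin.
- by move=> k; apply/measurable_EFinP.
by congr (limn _); apply/funext => k; exact: simple.
Qed.

End ge0_functional.

(** * Expectations along the splitting recursion *)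

Section kernel_pullback.
Context {d1 d2 d3 : measure_display} {T : measurableType d1}
  {X : measurableType d2} {Y : measurableType d3} {R : realType}.
Variables (k : R.-pker X ~> Y) (y : T -> X).
Hypothesis my : measurable_fun [set: T] y.

(** A sampling step integrates a function of the whole parameter t against a kernel that sees only
    the current state [y t]. Regarded as a kernel from [T], it falls under the measurability of
    parametrised integrals. *)
Definition kpullback (t : T) : {measure set Y -> \bar R} := k (y t).

Let measurable_kpullback U : measurable U -> measurable_fun [set: T] (kpullback ^~ U).
Proof.
by move=> mU; apply: (measurableT_comp (measurable_kernel k U mU)).
Qed.

HB.instance Definition _ :=
  isKernel.Build _ _ T Y R kpullback measurable_kpullback.

Let kpullback_setT t : kpullback t [set: Y] = 1%E.
Proof. exact: prob_kernel. Qed.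

HB.instance Definition _ :=
  Kernel_isProbability.Build _ _ T Y R kpullback kpullback_setT.

Lemma measurable_integral_kpullback (F : T * Y -> \bar R) :
  measurable_fun [set: T * Y] F -> (forall p, (0 <= F p)%E) ->
  measurable_fun [set: T] (fun t => \int[k (y t)]_z F (t, z))%E.
Proof.
move=> mF F0.
exact: (@measurable_fun_integral_finite_kernel _ _ _ _ _ F kpullback).
Qed.

End kernel_pullback.

(** * Measurability, linearity and expected sums for the splitting recursion *)

Section multilevel.
Context {R : realType} {d : nat}.
Local Notation E := (d.-tuple R).
Variables (S : E -> R) (g : nat -> \bar R) (s : nat) (kappa : nat -> R.-pker E ~> E).
Hypothesis mS : measurable_fun [set: E] S.
Local Open Scope ereal_scope.
Local Notation above := (above S g).
Local Notation chain := (chain S g kappa).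
Local Notation step := (step S g s kappa).
Local Notation run := (run S g s kappa).

Lemma measurable_above l : measurable_fun [set: E] (above l).
Proof.
apply: (measurable_fun_bool true).
have mS' : measurable_fun [set: E] (EFin \o S) by exact/measurable_EFinP.
exact: (emeasurable_fun_c_infty measurableT mS' (g l)).
Qed.

(** Measurability is asked on each length n, jointly with a parameter in [T] that carries whatever
    the continuation still remembers. *)
Definition measurable_functional {dT} {T : measurableType dT}
    (K : T -> seq E -> \bar R) : Prop :=
  forall n, measurable_fun [set: T * n.-tuple E] (fun p => K p.1 p.2).

Lemma chain_ge0 l j y acc K : (forall ys, 0 <= K ys) -> 0 <= chain l j y acc K.
Proof.
move=> K0; elim: j y acc => [//|j IHj] y acc /=.
by apply: integral_ge0 => z _; apply: IHj.
Qed.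

Lemma step_ge0 l xs acc K : (forall ys, 0 <= K ys) -> 0 <= step l xs acc K.
Proof.
move=> K0; elim: xs acc => [//|x xs IHxs] acc /=.
by apply: chain_ge0 => ys; apply: IHxs.
Qed.

Lemma run_ge0 k l xs K : (forall ys, 0 <= K ys) -> 0 <= run k l xs K.
Proof.
move=> K0; elim: k l xs => [//|k IHk] l xs /=.
by apply: step_ge0 => ys; apply: IHk.
Qed.

Lemma measurable_chain {dT} {T : measurableType dT} (K : T -> seq E -> \bar R) l j n :
  measurable_functional K -> (forall t ys, 0 <= K t ys) ->
  measurable_fun [set: T * E * n.-tuple E] (fun p => chain l j p.1.2 p.2 (K p.1.1)).
Proof.
move=> mK K0.
elim: j n => [|j IHj] n /=.
  apply: (measurableT_comp (mK n) (g := fun p : T * E * n.-tuple E => (p.1.1, p.2))).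
  by apply: measurable_fun_pair => //; exact: measurableT_comp.
pose F (q : T * E * n.-tuple E * E) : \bar R := chain l j q.2
  (if above l.+1 q.2 then q.2 :: tval q.1.2 else tval q.1.2) (K q.1.1.1).
suff mF : measurable_fun [set: T * E * n.-tuple E * E] F.
  apply: (@measurable_integral_kpullback _ _ _ _ _ _ _ (kappa l)
    (fun p : T * E * n.-tuple E => p.1.2) _ F) => //.
  - exact: measurableT_comp.
  - by move=> p; apply: chain_ge0.
(* The length of the new accumulator depends on whether z survives, so the test is pulled outside:
   each branch then has a fixed length, n + 1 or n. *)
have -> : F = fun q : T * E * n.-tuple E * E => if above l.+1 q.2
    then chain l j q.2 (cons_tuple q.2 q.1.2) (K q.1.1.1)
    else chain l j q.2 q.1.2 (K q.1.1.1).
  by apply/funext => q; rewrite /F; case: ifP.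
have m1 : measurable_fun [set: T * E * n.-tuple E * E] (fun q => (q.1.1.1, q.2)).
  apply: measurable_fun_pair => //.
  by do 2![apply: measurableT_comp => //].
apply: measurable_fun_ifT.
- apply: (measurableT_comp (measurable_above l.+1)) => //.
- apply: (measurableT_comp (IHj n.+1) (g := fun q : T * E * n.-tuple E * E =>
    ((q.1.1.1, q.2), cons_tuple q.2 q.1.2))); apply: measurable_fun_pair => //.
  by apply: measurable_cons => //; apply: measurableT_comp.
- apply: (measurableT_comp (IHj n) (g := fun q : T * E * n.-tuple E * E =>
    ((q.1.1.1, q.2), q.1.2))); apply: measurable_fun_pair => //.
  exact: measurableT_comp.
Qed.

Lemma measurable_step {dT} {T : measurableType dT} (K : T -> seq E -> \bar R) l m n :
  measurable_functional K -> (forall t ys, 0 <= K t ys) ->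
  measurable_fun [set: T * m.-tuple E * n.-tuple E]
    (fun p => step l p.1.2 p.2 (K p.1.1)).
Proof.
move=> mK K0.
elim: m n => [|m IHm] n.
  rewrite (_ : (fun _ => _) = fun p : T * 0.-tuple E * n.-tuple E => K p.1.1 p.2).
    apply: (measurableT_comp (mK n) (g := fun p : T * 0.-tuple E * n.-tuple E => (p.1.1, p.2))).
    by apply: measurable_fun_pair => //; exact: measurableT_comp.
  by apply/funext => p; rewrite (tuple0 p.1.2).
(* What follows the chain of the first particle depends on the particles still waiting, so these
   join the parameter space. *)
pose K' (q : T * m.+1.-tuple E) acc := step l (behead q.2) acc (K q.1).
have mK' : measurable_functional K'.
  move=> i; apply: (measurableT_comp (IHm i)
    (g := fun p : T * m.+1.-tuple E * i.-tuple E =>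
            ((p.1.1, [tuple of behead p.1.2]), p.2))).
  apply: measurable_fun_pair => //.
  apply: measurable_fun_pair; first exact: measurableT_comp.
  apply: (measurableT_comp (measurable_behead (n := m))).
  exact: measurableT_comp.
have K'0 q ys : 0 <= K' q ys by exact: step_ge0.
rewrite (_ : (fun _ => _) = fun p : T * m.+1.-tuple E * n.-tuple E =>
    chain l s (thead p.1.2) p.2 (K' p.1)).
  apply: (measurableT_comp (measurable_chain l s (n := n) mK' K'0)
    (g := fun p => ((p.1, thead p.1.2), p.2))).
  apply: measurable_fun_pair => //; apply: measurable_fun_pair => //.
  apply: (measurableT_comp (measurable_tnth ord0)).
  exact: measurableT_comp.
by apply/funext => -[[t w] acc] /=; rewrite /K' /=; case/tupleP: w => x w.
Qed.

Lemma measurable_run {dT} {T : measurableType dT} (K : T -> seq E -> \bar R) k l :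
  measurable_functional K -> (forall t ys, 0 <= K t ys) ->
  measurable_functional (fun t xs => run k l xs (K t)).
Proof.
move=> mK K0; elim: k l => [//|k IHk] l n /=.
apply: (measurableT_comp (measurable_step l (n := 0) (IHk l.+1) _)
  (g := fun p : T * n.-tuple E => (p, [tuple]))).
  by move=> *; apply: run_ge0.
exact: measurable_fun_pair.
Qed.

Definition ge0_measurable (K : seq E -> \bar R) : Prop :=
  (forall n, measurable_fun [set: n.-tuple E] (fun ys => K ys)) /\
  (forall ys, 0 <= K ys).

Lemma ge0_measurable_functional K : ge0_measurable K ->
  measurable_functional (fun _ : unit => K).
Proof. by move=> [mK _] n; apply: (measurableT_comp (mK n)). Qed.

Lemma measurable_functional_section (K : unit -> seq E -> \bar R) :
  measurable_functional K -> (forall ys, 0 <= K tt ys) -> ge0_measurable (K tt).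
Proof.
move=> mK K0; split=> // n.
by apply: (measurableT_comp (mK n) (g := pair tt)); exact: measurable_fun_pair.
Qed.

Lemma ge0_measurable_step l xs K : ge0_measurable K ->
  ge0_measurable (fun acc => step l xs acc K).
Proof.
move=> gK; split=> [n|ys]; last by apply: step_ge0; case: gK.
apply: (measurableT_comp (measurable_step l (m := size xs) (n := n)
  (ge0_measurable_functional gK) (fun _ => gK.2))
  (g := fun ys => ((tt, in_tuple xs), ys))).
exact: measurable_fun_pair.
Qed.

Lemma ge0_measurable_run k l K : ge0_measurable K ->
  ge0_measurable (fun xs => run k l xs K).
Proof.
move=> gK; apply: (measurable_functional_section (K := fun _ xs => run k l xs K)).
  by apply: measurable_run; [exact: ge0_measurable_functional|move=> _; case: gK].
by move=> ys; apply: run_ge0; case: gK.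
Qed.

Lemma measurable_chain_next l j acc K : ge0_measurable K ->
  measurable_fun [set: E]
    (fun z => chain l j z (if above l.+1 z then z :: acc else acc) K).
Proof.
move=> gK.
rewrite (_ : (fun z => _) = fun z => if above l.+1 z
    then chain l j z (cons_tuple z (in_tuple acc)) K
    else chain l j z (in_tuple acc) K); last first.
  by apply/funext => z; case: ifP.
have mc n := measurable_chain l j (n := n)
  (ge0_measurable_functional gK) (fun _ => gK.2).
apply: measurable_fun_ifT; first exact: measurable_above.
- apply: (measurableT_comp (mc _) (g := fun z => ((tt, z), cons_tuple z (in_tuple acc)))).
  apply: measurable_fun_pair; first exact: measurable_fun_pair.
  exact: measurable_cons.
- apply: (measurableT_comp (mc _) (g := fun z => ((tt, z), in_tuple acc))).
  by apply: measurable_fun_pair; first exact: measurable_fun_pair.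
Qed.

Lemma chainD l j y acc K1 K2 : ge0_measurable K1 -> ge0_measurable K2 ->
  chain l j y acc (fun ys => K1 ys + K2 ys) = chain l j y acc K1 + chain l j y acc K2.
Proof.
move=> g1 g2; elim: j y acc => [//|j IHj] y acc /=.
rewrite -ge0_integralD //; try exact: measurable_chain_next;
  try by move=> z _; apply: chain_ge0; case: g1; case: g2.
by apply: eq_integral => z _; rewrite IHj.
Qed.

Lemma chainZl l j y acc (c : R) K : ge0_measurable K -> (0 <= c)%R ->
  chain l j y acc (fun ys => c%:E * K ys) = c%:E * chain l j y acc K.
Proof.
move=> gK c0; elim: j y acc => [//|j IHj] y acc /=.
rewrite -ge0_integralZl //; try exact: measurable_chain_next;
  try by move=> z _; apply: chain_ge0; case: gK.
by apply: eq_integral => z _; rewrite IHj.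
Qed.

(** Each move adds at most one element. The size bound is carried along so that a trial is seen to
    return at most [s ^ (tau - 1)] elements, which makes the set of outcomes finite. *)
Lemma eq_chain l j y acc K1 K2 :
  (forall ys, (size ys <= size acc + j)%N -> K1 ys = K2 ys) ->
  chain l j y acc K1 = chain l j y acc K2.
Proof.
elim: j y acc => [|j IHj] y acc K12 /=; first by apply: K12; rewrite addn0.
apply: eq_integral => z _; apply: IHj => ys szys; apply: K12.
by apply: leq_trans szys _; case: ifP => _ /=; rewrite addnS ?addSn// ltnW.
Qed.

Lemma eq_step l xs acc K1 K2 :
  (forall ys, (size ys <= size acc + s * size xs)%N -> K1 ys = K2 ys) ->
  step l xs acc K1 = step l xs acc K2.
Proof.
elim: xs acc => [|x xs IHxs] acc K12 /=; first by apply: K12; rewrite muln0 addn0.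
apply: eq_chain => ys szys; apply: IHxs => zs szzs; apply: K12.
by apply: leq_trans szzs _; rewrite /= mulnS addnA leq_add2r.
Qed.

Lemma eq_run k l xs K1 K2 :
  (forall ys, (size ys <= s ^ k * size xs)%N -> K1 ys = K2 ys) ->
  run k l xs K1 = run k l xs K2.
Proof.
elim: k l xs => [|k IHk] l xs K12 /=; first by apply: K12; rewrite mul1n.
apply: eq_step => ys szys; apply: IHk => zs szzs; apply: K12.
by apply: leq_trans szzs _; rewrite expnSr -mulnA leq_mul2l szys orbT.
Qed.

Lemma stepD l xs acc K1 K2 : ge0_measurable K1 -> ge0_measurable K2 ->
  step l xs acc (fun ys => K1 ys + K2 ys) = step l xs acc K1 + step l xs acc K2.
Proof.
move=> g1 g2; elim: xs acc => [//|x xs IHxs] acc /=.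
rewrite -chainD; try exact: ge0_measurable_step.
by apply: eq_chain => ys _; exact: IHxs.
Qed.

Lemma stepZl l xs acc (c : R) K : ge0_measurable K -> (0 <= c)%R ->
  step l xs acc (fun ys => c%:E * K ys) = c%:E * step l xs acc K.
Proof.
move=> gK c0; elim: xs acc => [//|x xs IHxs] acc /=.
rewrite -chainZl//; try exact: ge0_measurable_step.
by apply: eq_chain => ys _; exact: IHxs.
Qed.

Lemma runD k l xs K1 K2 : ge0_measurable K1 -> ge0_measurable K2 ->
  run k l xs (fun ys => K1 ys + K2 ys) = run k l xs K1 + run k l xs K2.
Proof.
move=> g1 g2; elim: k l xs => [//|k IHk] l xs /=.
rewrite -stepD; try exact: ge0_measurable_run.
by apply: eq_step => ys _; exact: IHk.
Qed.

Lemma runZl k l xs (c : R) K : ge0_measurable K -> (0 <= c)%R ->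
  run k l xs (fun ys => c%:E * K ys) = c%:E * run k l xs K.
Proof.
move=> gK c0; elim: k l xs => [//|k IHk] l xs /=.
rewrite -stepZl//; try exact: ge0_measurable_run.
by apply: eq_step => ys _; exact: IHk.
Qed.

Lemma integral_kernel_cst l y (c : \bar R) : \int[kappa l y]_z c = c.
Proof. by rewrite integral_cst// prob_kernel mule1. Qed.

(* [survivors l j h y] is the expected value of the sum of [h] over those of
   the [j] successive states of a chain started at [y] that reach level [l+1]. *)
Fixpoint survivors l j (h : E -> \bar R) (y : E) : \bar R :=
  match j with
  | 0 => 0
  | j'.+1 => \int[kappa l y]_z
      ((if above l.+1 z then h z else 0) + survivors l j' h z)
  end.

(** The expected sum of h over the population that stems from a single particle after k further
    stages. *)
Fixpoint descendants k l (h : E -> \bar R) : E -> \bar R :=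
  match k with
  | 0 => h
  | k'.+1 => survivors l s (descendants k' l.+1 h)
  end.

Lemma survivors_ge0 l j h : (forall x, 0 <= h x) -> forall y, 0 <= survivors l j h y.
Proof.
move=> h0; elim: j => [//|j IHj] y /=.
by apply: integral_ge0 => z _; apply: adde_ge0 => //; case: ifP.
Qed.

Lemma measurable_if_above l (h : E -> \bar R) : measurable_fun [set: E] h ->
  measurable_fun [set: E] (fun z => if above l z then h z else 0).
Proof.
by move=> mh; apply: (measurable_fun_ifT (measurable_above l) mh); exact: measurable_cst.
Qed.

Lemma measurable_survivors l j (h : E -> \bar R) :
  measurable_fun [set: E] h -> (forall x, 0 <= h x) ->
  measurable_fun [set: E] (survivors l j h).
Proof.
move=> mh h0; elim: j => [|j IHj] /=; first exact: measurable_cst.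
apply: (@measurable_fun_integral_kernel _ _ _ _ _ (kappa l)
  (measurable_kernel (kappa l))
  (fun z => (if above l.+1 z then h z else 0) + survivors l j h z)).
- by move=> z; apply: adde_ge0; [case: ifP|exact: survivors_ge0].
- by apply: emeasurable_funD => //; exact: measurable_if_above.
Qed.

Lemma descendants_ge0 k l h : (forall x, 0 <= h x) -> forall y, 0 <= descendants k l h y.
Proof. by elim: k l => [//|k IHk] l h0; apply: survivors_ge0; exact: IHk. Qed.

Lemma measurable_descendants k l (h : E -> \bar R) :
  measurable_fun [set: E] h -> (forall x, 0 <= h x) ->
  measurable_fun [set: E] (descendants k l h).
Proof.
move=> mh h0; elim: k l => [//|k IHk] l.
by apply: measurable_survivors => //; exact: descendants_ge0.
Qed.

(** The constant c stands for the expected contribution of the particles not yet processed, which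
    [step] leaves inside the continuation. *)
Lemma chain_sum l j y acc (h : E -> \bar R) c :
  measurable_fun [set: E] h -> (forall x, 0 <= h x) -> 0 <= c ->
  chain l j y acc (fun ys => \sum_(x <- ys) h x + c) =
  \sum_(x <- acc) h x + c + survivors l j h y.
Proof.
move=> mh h0 c0; elim: j y acc => [|j IHj] y acc /=; first by rewrite adde0.
have m1 := measurable_if_above l.+1 mh.
have m2 := measurable_survivors l j mh h0.
rewrite -[X in X + _](integral_kernel_cst l y) -ge0_integralD //.
- apply: eq_integral => z _; rewrite IHj; case: ifP => _; last by rewrite add0e.
  by rewrite big_cons -!addeA addeCA; congr (_ + _); rewrite addeCA.
- by move=> z _; apply: adde_ge0 => //; apply: sume_ge0.
- by move=> z _; apply: adde_ge0; [case: ifP|exact: survivors_ge0].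
- by apply: emeasurable_funD.
Qed.

Lemma step_sum l xs acc (h : E -> \bar R) : measurable_fun [set: E] h -> (forall x, 0 <= h x) ->
  step l xs acc (fun ys => \sum_(x <- ys) h x) =
  \sum_(x <- acc) h x + \sum_(x <- xs) survivors l s h x.
Proof.
move=> mh h0; elim: xs acc => [|x xs IHxs] acc /=; first by rewrite big_nil adde0.
under eq_chain do rewrite IHxs.
rewrite chain_sum//; last by apply: sume_ge0 => *; exact: survivors_ge0.
by rewrite big_cons -addeA; congr (_ + _); rewrite addeC.
Qed.

Lemma run_sum k l xs (h : E -> \bar R) : measurable_fun [set: E] h -> (forall x, 0 <= h x) ->
  run k l xs (fun ys => \sum_(x <- ys) h x) = \sum_(x <- xs) descendants k l h x.
Proof.
move=> mh h0; elim: k l xs => [//|k IHk] l xs /=.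
transitivity (step l xs [::] (fun ys => \sum_(x <- ys) descendants k l.+1 h x)).
  by apply: eq_step => ys _; exact: IHk.
rewrite step_sum ?big_nil ?add0e//; first exact: measurable_descendants.
exact: descendants_ge0.
Qed.

Lemma run_cst k l xs (c : \bar R) : run k l xs (fun=> c) = c.
Proof.
have chain_cst j y acc l' : chain l' j y acc (fun=> c) = c.
  elim: j y acc => [//|j IHj] y acc /=.
  by under eq_integral do rewrite IHj; exact: integral_kernel_cst.
have step_cst ys acc l' : step l' ys acc (fun=> c) = c.
  elim: ys acc => [//|y ys IHys] acc /=.
  rewrite -[RHS](chain_cst s y acc l').
  by apply: eq_chain => zs _; exact: IHys.
elim: k l xs => [//|k IHk] l xs /=.
rewrite -[RHS](step_cst xs [::] l).
by apply: eq_step => zs _; exact: IHk.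
Qed.

End multilevel.

(** * Ratio estimators *)

Section expectation.
Context {R : realType} {T : Type}.

(** Abstract because the same moment inequalities are applied to one trial and to n independent
    ones. [L] acts on all functions, without integrability conditions, since both laws have finite
    support. *)
Record expectation (L : (T -> R) -> R) := {
  expectation1 : L (fun=> 1) = 1 ;
  expectationD : forall X Y, L (fun t => X t + Y t) = L X + L Y ;
  expectationZ : forall c X, L (fun t => c * X t) = c * L X ;
  expectation_le : forall X Y, (forall t, X t <= Y t) -> L X <= L Y }.

Variable L : (T -> R) -> R.
Hypothesis HL : expectation L.

Lemma eq_expectation X Y : X =1 Y -> L X = L Y.
Proof. by move=> /funext ->. Qed.

Lemma expectation_cst c : L (fun=> c) = c.
Proof.
rewrite -[RHS]mulr1 -(expectation1 HL) -(expectationZ HL).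
by apply: eq_expectation => t; rewrite mulr1.
Qed.

Lemma expectationB X Y : L (fun t => X t - Y t) = L X - L Y.
Proof.
rewrite -mulN1r -(expectationZ HL) -(expectationD HL).
by apply: eq_expectation => t; rewrite mulN1r.
Qed.

Lemma expectation_ge0 X : (forall t, 0 <= X t) -> 0 <= L X.
Proof. by move=> X0; rewrite -(expectation_cst 0); apply: (expectation_le HL). Qed.

Lemma expectation_norm_le X : `|L X| <= L (fun t => `|X t|).
Proof.
rewrite ler_norml lerNl -mulN1r -(expectationZ HL); apply/andP; split;
  apply: (expectation_le HL) => t; last exact: ler_norm.
by rewrite mulN1r -normrN ler_norm.
Qed.

(** The quadratic form E[(uX + vY)^2] is nonnegative. At (u, v) = (c, -b) it equals c (a c - b^2),
    and at (-b, a) it equals a (a c - b^2), so one nonzero second moment is enough. *)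
Lemma expectation_CauchySchwarz X Y :
  L (fun t => X t * Y t) ^+ 2 <= L (fun t => X t ^+ 2) * L (fun t => Y t ^+ 2).
Proof.
set a := L (fun t => X t ^+ 2); set c := L (fun t => Y t ^+ 2).
set b := L _.
have quad u v : 0 <= u ^+ 2 * a + 2 * u * v * b + v ^+ 2 * c.
  rewrite -!(expectationZ HL) -!(expectationD HL).
  apply: expectation_ge0 => t.
  rewrite (_ : _ + _ = (u * X t + v * Y t) ^+ 2) ?sqr_ge0//; ring.
have a0 : 0 <= a by apply: expectation_ge0 => t; rewrite sqr_ge0.
have c0 : 0 <= c by apply: expectation_ge0 => t; rewrite sqr_ge0.
have [c_gt0|] := ltP 0 c.
  rewrite -(ler_pM2l c_gt0); have := quad c (- b); nra.
move=> c_le0; have cE : c = 0 by apply/eqP; rewrite eq_le c_le0.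
have [a_gt0|] := ltP 0 a.
  rewrite -(ler_pM2l a_gt0); have := quad (- b) a; nra.
move=> a_le0; have aE : a = 0 by apply/eqP; rewrite eq_le a_le0.
(* With both second moments zero the form is 2uvb, and the two signs of uv force b = 0. *)
have := quad 1 1; have := quad 1 (-1); rewrite aE cE => h1 h2.
have -> : b = 0 by lra.
by rewrite expr0n mul0r.
Qed.

Lemma expectation_normM X Y :
  L (fun t => `|X t * Y t|) <=
  Num.sqrt (L (fun t => X t ^+ 2) * L (fun t => Y t ^+ 2)).
Proof.
rewrite -[leLHS]ger0_norm ?expectation_ge0// -sqrtr_sqr ler_wsqrtr//.
have := expectation_CauchySchwarz (fun t => `|X t|) (fun t => `|Y t|).
rewrite (_ : (fun t => `|X t| * `|Y t|) = (fun t => `|X t * Y t|)); last first.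
  by apply/funext => t; rewrite normrM.
rewrite (_ : (fun t => `|X t| ^+ 2) = (fun t => X t ^+ 2)); last first.
  by apply/funext => t; rewrite real_normK// num_real.
by rewrite (_ : (fun t => `|Y t| ^+ 2) = (fun t => Y t ^+ 2))//; apply/funext => t;
  rewrite real_normK// num_real.
Qed.

Lemma expectation_norm_sqrt X :
  L (fun t => `|X t|) <= Num.sqrt (L (fun t => X t ^+ 2)).
Proof.
have := expectation_normM X (fun=> 1).
rewrite (_ : (fun=> 1 ^+ 2) = (fun=> 1)); last by apply/funext => t; rewrite expr1n.
rewrite (expectation1 HL) mulr1.
by under eq_expectation do rewrite mulr1.
Qed.

End expectation.

(** * Sums of independent copies under a finite law *)

Section iid.
Context {R : realType} {Omega : finType}.
Variable p : Omega -> R.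
Hypotheses (p_ge0 : forall w, 0 <= p w) (p_sum1 : \sum_w p w = 1).

Definition fexp (X : Omega -> R) : R := \sum_w p w * X w.

(** The product law is nested in the same way as [multiE], so that the two are matched by induction
    on the number of trials. *)
Fixpoint iidexp n (X : seq Omega -> R) : R :=
  match n with
  | 0 => X [::]
  | n'.+1 => fexp (fun w => iidexp n' (fun ws => X (w :: ws)))
  end.

Lemma fexp_expectation : expectation fexp.
Proof.
split => [|X Y|c X|X Y le_XY].
- by rewrite /fexp -[RHS]p_sum1; apply: eq_bigr => w _; rewrite mulr1.
- by rewrite /fexp -big_split; apply: eq_bigr => w _; rewrite mulrDr.
- by rewrite /fexp mulr_sumr; apply: eq_bigr => w _; rewrite mulrCA.
- by apply: ler_sum => w _; rewrite ler_wpM2l.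
Qed.

(** The restriction to lists of length n is used later: the centring of the sum of M by n m, and the
    bound of that sum below by n, hold only there. *)
Lemma iidexp_le n X Y : (forall ws, size ws = n -> X ws <= Y ws) ->
  iidexp n X <= iidexp n Y.
Proof.
elim: n X Y => [|n IHn] X Y le_XY /=; first exact: le_XY.
apply: (expectation_le fexp_expectation) => w; apply: IHn => ws ws_n.
by apply: le_XY; rewrite /= ws_n.
Qed.

Lemma eq_iidexp n X Y : (forall ws, size ws = n -> X ws = Y ws) ->
  iidexp n X = iidexp n Y.
Proof.
by move=> eqXY; apply/eqP; rewrite eq_le !iidexp_le// => ws /eqXY ->.
Qed.

Lemma iidexp_expectation n : expectation (iidexp n).
Proof.
split => [|X Y|c X|X Y le_XY].
- elim: n => [//|n IHn] /=; rewrite -[RHS](expectation1 fexp_expectation).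
  by apply: eq_expectation => w.
- elim: n X Y => [//|n IHn] X Y /=; rewrite -(expectationD fexp_expectation).
  by apply: eq_expectation => w; rewrite IHn.
- elim: n X => [//|n IHn] X /=; rewrite -(expectationZ fexp_expectation).
  by apply: eq_expectation => w; rewrite IHn.
- by apply: iidexp_le.
Qed.

Lemma iidexp_sum n X :
  iidexp n (fun ws => \sum_(w <- ws) X w) = n%:R * fexp X.
Proof.
elim: n => [|n IHn] /=; first by rewrite big_nil mul0r.
under eq_expectation do under eq_iidexp do rewrite big_cons.
under eq_expectation do rewrite (expectationD (iidexp_expectation n))
  (expectation_cst (iidexp_expectation n)) IHn.
rewrite (expectationD fexp_expectation) (expectation_cst fexp_expectation).
by rewrite mulrS mulrDl mul1r.
Qed.

(** Products of values from two different trials have mean zero by independence and centring, so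
    only the n diagonal terms remain. *)
Lemma iidexp_sumM n X Y : fexp X = 0 -> fexp Y = 0 ->
  iidexp n (fun ws => (\sum_(w <- ws) X w) * (\sum_(w <- ws) Y w)) =
  n%:R * fexp (fun w => X w * Y w).
Proof.
move=> X0 Y0; elim: n => [|n IHn] /=; first by rewrite !big_nil !mul0r.
have En := iidexp_expectation n.
transitivity (fexp (fun w => X w * Y w + n%:R * fexp (fun w => X w * Y w))).
  apply: eq_expectation => w; rewrite -IHn.
  transitivity (iidexp n (fun ws => (X w * Y w + (X w * \sum_(w <- ws) Y w
      + Y w * \sum_(w <- ws) X w)) +
      (\sum_(w <- ws) X w) * (\sum_(w <- ws) Y w))).
    by apply: eq_iidexp => ws _; rewrite !big_cons; ring.
  rewrite !(expectationD En) !(expectationZ En) (expectation_cst En).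
  by rewrite !iidexp_sum X0 Y0 !mulr0 !addr0.
rewrite (expectationD fexp_expectation) (expectation_cst fexp_expectation).
by rewrite mulrS mulrDl mul1r.
Qed.

End iid.

(** * Bias and L1 error of a ratio of sums *)

Section ratio_estimator.
Context {R : realType} {Omega : finType}.
Variables (p M H : Omega -> R) (q : R).
Hypotheses (p_ge0 : forall w, 0 <= p w) (p_sum1 : \sum_w p w = 1).
Hypotheses (M_ge1 : forall w, 1 <= M w) (H_ge0 : forall w, 0 <= H w)
  (H_leM : forall w, H w <= M w) (q_ge0 : 0 <= q) (q_le1 : q <= 1).
Local Notation E := (fexp p).
Local Notation EE := (iidexp p).
Hypothesis EH : E H = q * E M.

Let m := E M.
Let M2 := E (fun w => M w ^+ 2).
Let M4 := E (fun w => M w ^+ 4).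
Let V := M2 - m ^+ 2.
Let D w := H w - q * M w.
Let C w := m - M w.
Let ratio (ws : seq Omega) := (\sum_(w <- ws) H w) / (\sum_(w <- ws) M w).

Let HE : expectation E := fexp_expectation p_ge0 p_sum1.
Let HEE n : expectation (EE n) := iidexp_expectation p_ge0 p_sum1 n.

Let M_gt0 w : 0 < M w. Proof. exact: lt_le_trans (M_ge1 w). Qed.

Let m_gt0 : 0 < m.
Proof.
apply: (@lt_le_trans _ _ 1) => //; rewrite -(expectation1 HE).
exact: (expectation_le HE).
Qed.

Let sumM_ge ws : (size ws)%:R <= \sum_(w <- ws) M w.
Proof.
elim: ws => [|w ws IHws]; first by rewrite big_nil.
by rewrite big_cons /= mulrS lerD.
Qed.

Let ED : E D = 0.
Proof. by rewrite /D (expectationB HE) (expectationZ HE) EH subrr. Qed.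

Let EC : E C = 0.
Proof. by rewrite /C (expectationB HE) (expectation_cst HE) subrr. Qed.

Let norm_D w : `|D w| <= M w.
Proof.
have Mw := ltW (M_gt0 w); have qM0 := mulr_ge0 q_ge0 Mw.
have qM1 := ler_piMl Mw q_le1; have := H_ge0 w; have := H_leM w.
by rewrite ler_norml /D => h1 h2; apply/andP; split; lra.
Qed.

Let ED2 : E (fun w => D w ^+ 2) <= M2.
Proof.
apply: (expectation_le HE) => w; rewrite -[leLHS]real_normK ?num_real//.
by rewrite ler_pXn2r ?nnegrE// ltW.
Qed.

Let EC2 : E (fun w => C w ^+ 2) = V.
Proof.
transitivity (E (fun w => (m ^+ 2 - (2 * m) * M w) + M w ^+ 2)).
  by apply: eq_expectation => w; rewrite /C; ring.
rewrite (expectationD HE) (expectationB HE) (expectationZ HE) (expectation_cst HE).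
by rewrite /V -/M2 -/m; ring.
Qed.

Let M2_ge0 : 0 <= M2.
Proof. by apply: (expectation_ge0 HE) => w; rewrite sqr_ge0. Qed.

Let V_ge0 : 0 <= V.
Proof. by rewrite -EC2; apply: (expectation_ge0 HE) => w; rewrite sqr_ge0. Qed.

Let sumD ws : \sum_(w <- ws) D w = (ratio ws - q) * \sum_(w <- ws) M w.
Proof.
rewrite /D sumrB -mulr_sumr mulrBl; congr (_ - _); rewrite /ratio.
(* On the empty list the ratio is 0 / 0, and the identity reads 0 = 0; otherwise the denominator is
   at least 1. *)
case: ws => [|w ws]; first by rewrite !big_nil mulr0.
rewrite mulfVK// gt_eqF//; apply: (lt_le_trans _ (sumM_ge _)).
by rewrite ltr0n.
Qed.

Let sumC n ws : size ws = n -> \sum_(w <- ws) C w = n%:R * m - \sum_(w <- ws) M w.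
Proof. by move=> <-; rewrite /C sumrB big_const_seq count_predT iter_addr_0 mulr_natl. Qed.

Let ratio_bound ws : `|ratio ws - q| <= 1.
Proof.
have h0 : 0 <= \sum_(w <- ws) H w by apply: sumr_ge0.
have h1 : \sum_(w <- ws) H w <= \sum_(w <- ws) M w by apply: ler_sum.
have r0 : 0 <= ratio ws by rewrite divr_ge0// (le_trans h0).
have r1 : ratio ws <= 1.
  rewrite /ratio; have [->|M0] := eqVneq (\sum_(w <- ws) M w) 0.
    by rewrite invr0 mulr0.
  by rewrite ler_pdivrMr ?mul1r// lt_neqAle eq_sym M0 (le_trans h0).
move: r0 r1 q_ge0 q_le1; move: (ratio ws) => r *.
by rewrite ler_norml; apply/andP; split; lra.
Qed.

Lemma ratio_bias n : (0 < n)%N ->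
  `|EE n ratio - q| <= (V + Num.sqrt (V * M2)) / m ^+ 2 / n%:R.
Proof.
move=> n_gt0; have nR_gt0 : 0 < n%:R :> R by rewrite ltr0n.
set nu := n%:R * m; have nu_gt0 : 0 < nu by rewrite mulr_gt0.
have nu_neq0 : nu != 0 by rewrite gt_eqF.
pose SD ws := \sum_(w <- ws) D w; pose SC ws := \sum_(w <- ws) C w.
(* In terms of sums, ratio - q = SD / nu + SD SC / nu^2 + (ratio - q) SC^2 / nu^2. The last two
   numerators have expectations of order n, against nu^2 = n^2 m^2; this is the origin of the rate 1
   / n. *)
have -> : EE n ratio - q =
    nu ^- 2 * (n%:R * E (fun w => D w * C w) + EE n (fun ws => (ratio ws - q) * (SC ws * SC ws))).
  rewrite -[X in _ - X](expectation_cst (HEE n)) -(expectationB (HEE n)).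
  rewrite -(iidexp_sumM p_ge0 p_sum1 n ED EC) -/SD -/SC.
  rewrite -(expectationD (HEE n)) -(expectationZ (HEE n)).
  transitivity (EE n (fun ws => nu^-1 * SD ws +
      nu ^- 2 * (SD ws * SC ws + (ratio ws - q) * (SC ws * SC ws)))).
    apply: (eq_iidexp p_ge0 p_sum1) => ws ws_n.
    by rewrite /SD sumD /SC (sumC ws_n) -/nu; field.
  by rewrite (expectationD (HEE n)) !(expectationZ (HEE n)) /SD iidexp_sum// ED !mulr0 add0r.
have b1 : `|E (fun w => D w * C w)| <= Num.sqrt (V * M2).
  apply: le_trans (expectation_norm_le HE _) _.
  apply: le_trans (expectation_normM HE _ _) _.
  by rewrite EC2 mulrC ler_wsqrtr// ler_wpM2l.
have b2 : `|EE n (fun ws => (ratio ws - q) * (SC ws * SC ws))| <= n%:R * V.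
  rewrite -EC2; apply: le_trans (expectation_norm_le (HEE n) _) _.
  rewrite -(_ : (fun w => C w * C w) = (fun w => C w ^+ 2)); last first.
    by apply/funext => w; rewrite expr2.
  rewrite -(iidexp_sumM p_ge0 p_sum1 n EC EC) -/SC.
  apply: (expectation_le (HEE n)) => ws.
  by rewrite normrM -[leRHS]mul1r -expr2 normrX real_normK ?num_real// ler_wpM2r ?sqr_ge0.
rewrite normrM ger0_norm ?invr_ge0 ?exprn_ge0 ?(ltW nu_gt0)//.
rewrite (_ : _ / m ^+ 2 / n%:R = nu ^- 2 * (n%:R * Num.sqrt (V * M2) + n%:R * V)); last first.
  by rewrite /nu; field; rewrite !gt_eqF.
rewrite ler_wpM2l ?invr_ge0 ?exprn_ge0 ?(ltW nu_gt0)//.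
apply: le_trans (ler_normD _ _) _; apply: lerD => //.
by rewrite normrM normr_nat ler_wpM2l// ltW.
Qed.

Lemma ratio_L1 n : (0 < n)%N ->
  EE n (fun ws => `|ratio ws - q|) <=
  (Num.sqrt M2 + Num.sqrt (3 * M4 / n%:R)) / m / Num.sqrt n%:R.
Proof.
move=> n_gt0; have nR_gt0 : 0 < n%:R :> R by rewrite ltr0n.
set nu := n%:R * m; have nu_gt0 : 0 < nu by rewrite mulr_gt0.
have nu_neq0 : nu != 0 by rewrite gt_eqF.
pose SD ws := \sum_(w <- ws) D w; pose SC ws := \sum_(w <- ws) C w.
set r := Num.sqrt n%:R; have r_gt0 : 0 < r by rewrite sqrtr_gt0.
have nE : n%:R = r ^+ 2 by rewrite sqr_sqrtr// ltW.
have ESD2 : EE n (fun ws => SD ws ^+ 2) <= n%:R * M2.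
  under eq_expectation do rewrite expr2.
  by rewrite iidexp_sumM// ler_wpM2l// ?(ltW nR_gt0)//; exact: ED2.
have ESC2 : EE n (fun ws => SC ws ^+ 2) = n%:R * V.
  under eq_expectation do rewrite expr2.
  by rewrite iidexp_sumM//; congr (_ * _); exact: EC2.
(* Cauchy-Schwarz for [M ^+ 2] against the constant 1. *)
have M2M4 : M2 <= Num.sqrt M4.
  apply: le_trans (le_trans _ (expectation_norm_sqrt HE (fun w => M w ^+ 2))) _.
    by apply: (expectation_le HE) => w; exact: ler_norm.
  by apply: ler_wsqrtr; apply: (expectation_le HE) => w; rewrite -exprM.
have b1 : EE n (fun ws => `|SD ws|) <= r * Num.sqrt M2.
  apply: le_trans (expectation_norm_sqrt (HEE n) _) _.
  by rewrite /r -sqrtrM ?ler_wsqrtr// ltW.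
have b2 : EE n (fun ws => `|SD ws * SC ws|) <= n%:R * M2.
  apply: le_trans (expectation_normM (HEE n) _ _) _.
  rewrite ESC2 -[leRHS]ger0_norm ?mulr_ge0 ?(ltW nR_gt0)// -sqrtr_sqr ler_wsqrtr//.
  rewrite expr2; apply: ler_pM => //.
  - by apply: (expectation_ge0 (HEE n)) => ws; rewrite sqr_ge0.
  - by rewrite mulr_ge0// ltW.
  (* The variance of M is at most its second moment, so E|SD SC| is bounded by n [M2] alone. *)
  - by rewrite ler_wpM2l ?(ltW nR_gt0)// /V gerBl sqr_ge0.
apply: (@le_trans _ _ (EE n (fun ws => nu^-1 * `|SD ws| + (nu^-1 / n%:R) * `|SD ws * SC ws|))).
  apply: iidexp_le => // ws ws_n.
  have Mn : n%:R <= \sum_(w <- ws) M w by rewrite -ws_n.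
  have e : ratio ws - q = nu^-1 * SD ws + nu^-1 * ((ratio ws - q) * SC ws).
    by rewrite /SD sumD /SC (sumC ws_n) -/nu; field.
  rewrite [in leLHS]e; apply: le_trans (ler_normD _ _) _.
  have nuV : `|nu^-1| = nu^-1 by rewrite ger0_norm// invr_ge0 ltW.
  rewrite !(normrM nu^-1) nuV lerD2l -mulrA ler_wpM2l ?invr_ge0 ?(ltW nu_gt0)//.
  rewrite !normrM mulrA ler_wpM2r// /SD sumD normrM mulrCA ler_peMr//.
  by rewrite ler_pdivlMl// mulr1 (le_trans Mn)// ler_norm.
rewrite (expectationD (HEE n)) !(expectationZ (HEE n)).
rewrite (_ : _ / m / r = nu^-1 * (r * Num.sqrt M2) +
    (nu^-1 / n%:R) * (n%:R * (r * Num.sqrt (3 * M4 / n%:R)))); last first.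
  by rewrite /nu nE; field; rewrite !gt_eqF.
apply: lerD;
  rewrite ler_wpM2l ?invr_ge0 ?mulr_ge0 ?invr_ge0 ?(ltW nu_gt0) ?(ltW nR_gt0) ?(ltW m_gt0)//.
(* The factor r = sqrt n cancels the division by n under the root; what is left is [M2] <=
   sqrt([M4]) <= sqrt(3 [M4]). *)
apply: le_trans b2 _; rewrite ler_wpM2l ?(ltW nR_gt0)//.
apply: le_trans M2M4 _.
have M4_ge0 : 0 <= M4.
  by apply: (expectation_ge0 HE) => w; rewrite exprn_even_ge0.
rewrite /r -sqrtrM ?ler_wsqrtr ?(ltW nR_gt0)// mulrC mulfVK ?gt_eqF//.
by lra.
Qed.

End ratio_estimator.

(** * The law of a non-empty trial *)

Section weighted_iint.
Context {R : realType} {d : nat}.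
Local Notation E := (d.-tuple R).
Local Open Scope ereal_scope.

Lemma iint_weighted_functional (w : E -> R) :
  measurable_fun [set: E] w -> (forall x, (0 <= w x)%R) ->
  ge0_functional (fun h : E -> \bar R => iint (fun x => (w x)%:E * h x)).
Proof.
move=> mw w0.
have mwh (h : E -> \bar R) : measurable_fun [set: E] h ->
    measurable_fun [set: E] (fun x => (w x)%:E * h x).
  by move=> mh; apply: emeasurable_funM => //; exact/measurable_EFinP.
have wh0 (h : E -> \bar R) : (forall x, 0 <= h x) -> forall x, 0 <= (w x)%:E * h x.
  by move=> h0 x; apply: mule_ge0 => //; rewrite lee_fin.
split.
- move=> h1 h2 m1 p1 m2 p2; rewrite -iintD; try by [exact: mwh|exact: wh0].
  by congr iint; apply/funext => x; rewrite ge0_muleDr.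
- move=> k h mh h0 k0; rewrite -iintZl; try by [exact: mwh|exact: wh0|].
  by congr iint; apply/funext => x; rewrite muleCA.
- move=> h mh h0 nh; rewrite -iint_monotone_convergence.
  + congr iint; apply/funext => x; rewrite -limeMl//.
    by apply: ereal_nondecreasing_is_cvgn; exact: nh.
  + by move=> k; exact: mwh.
  + by move=> k; exact: wh0.
  + by move=> x a b ab; apply: lee_wpmul2l; [rewrite lee_fin|exact: nh].
Qed.

(** Applied to a level integral, this is the law after one move of the chain, the left-hand side of
    stationarity. *)
Lemma kernel_functional (k : R.-pker E ~> E) (I : (E -> \bar R) -> \bar R) :
  ge0_functional I -> ge0_functional (fun h => I (fun x => \int[k x]_y h y)).
Proof.
move=> HI.
have mk (h : E -> \bar R) : measurable_fun [set: E] h -> (forall x, 0 <= h x) ->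
    measurable_fun [set: E] (fun x => \int[k x]_y h y).
  by move=> mh h0; apply: measurable_fun_integral_kernel => //; exact: measurable_kernel.
have k0 (h : E -> \bar R) : (forall x, 0 <= h x) -> forall x, 0 <= \int[k x]_y h y.
  by move=> h0 x; apply: integral_ge0.
split.
- move=> h1 h2 m1 p1 m2 p2; rewrite -(functionalD HI); try by [exact: mk|exact: k0].
  by congr I; apply/funext => x; rewrite ge0_integralD.
- move=> c h mh h0 c0; rewrite -(functionalZl HI); try by [exact: mk|exact: k0|].
  by congr I; apply/funext => x; rewrite ge0_integralZl.
- move=> h mh h0 nh; rewrite -(functional_lim HI).
  + by congr I; apply/funext => x; rewrite monotone_convergence// => y _; exact: nh.
  + by move=> i; exact: mk.
  + by move=> i; exact: k0.
  + by move=> x a b ab; apply: ge0_le_integral => // y _; exact: nh.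
Qed.

End weighted_iint.

(** * Expected counts of a trial through stationarity *)

Section splitting.
Context {R : realType} {d : nat}.
Local Notation E := (d.-tuple R).
Variables (f S : E -> R) (gam : R) (s tau : nat) (g : nat -> \bar R)
  (kappa : nat -> R.-pker E ~> E).
Hypotheses (mf : measurable_fun [set: E] f) (f_ge0 : forall x, 0 <= f x)
  (f1 : iint (fun x => (f x)%:E) = 1%E) (mS : measurable_fun [set: E] S)
  (gam_pos : (0 < iint (fun x => (f x * \1_[set y | gam <= S y] x)%:E))%E)
  (s_ge2 : (2 <= s)%N) (tau_gt0 : (1 <= tau)%N)
  (g_lt : forall l, (l < tau)%N -> (g l < g l.+1)%E) (g_tau : g tau = gam%:E)
  (kappa_st : forall l, (l <= tau)%N -> stationary f S g kappa l).
Local Open Scope ereal_scope.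
Local Notation above := (above S g).
Local Notation run := (run S g s kappa).
Local Notation survivors := (survivors S g kappa).
Local Notation descendants := (descendants S g s kappa).
Local Notation trialE := (trialE f S g s tau kappa).
Local Notation neE := (neE f S g s tau kappa).

(** Integration against f restricted to level l, left unnormalised so that no ratios of level
    probabilities appear when passing from one level to the next. *)
Definition level_int l (h : E -> \bar R) : \bar R :=
  iint (fun x => (f x * (above l x)%:R)%:E * h x).

Let measurable_above_indic l : measurable_fun [set: E] (fun x => (above l x)%:R : R).
Proof.
apply: (measurableT_comp (f := fun b : bool => b%:R : R) _ (measurable_above g mS l)).
by move=> _ ? _; exact: I.
Qed.

Let measurable_weight l : measurable_fun [set: E] (fun x => f x * (above l x)%:R)%R.
Proof. exact: measurable_funM. Qed.

Let weight_ge0 l x : (0 <= f x * (above l x)%:R)%R.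
Proof. by rewrite mulr_ge0. Qed.

Lemma level_int_functional l : ge0_functional (level_int l).
Proof. exact: iint_weighted_functional. Qed.

Lemma le_above l1 l2 x : (l1 <= l2 <= tau)%N -> above l2 x -> above l1 x.
Proof.
move=> /andP[l12]; rewrite -(subnKC l12); elim: (l2 - l1)%N => [|k IHk].
  by rewrite addn0.
rewrite addnS => lk /= a2; apply: IHk; first exact: ltnW.
by apply: le_trans a2; exact/ltW/g_lt.
Qed.

Lemma above_tauE x : above tau x = (gam <= S x)%R.
Proof. by rewrite /Defs.above g_tau lee_fin. Qed.

Lemma level_int1_tau :
  level_int tau (fun=> 1) = iint (fun x => (f x * \1_[set y | gam <= S y]%R x)%:E).
Proof.
congr iint; apply/funext => x; rewrite mule1 above_tauE indicE.
by congr (_ * (nat_of_bool _)%:R)%:E; apply/idP/idP; rewrite inE.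
Qed.

Lemma level_int1_gt0 l : (l <= tau)%N -> 0 < level_int l (fun=> 1).
Proof.
move=> ltau; apply: (lt_le_trans gam_pos); rewrite -level_int1_tau.
apply: le_iint => [|x||x].
- by apply: emeasurable_funM => //; exact/measurable_EFinP.
- by rewrite mule1 lee_fin.
- by apply: emeasurable_funM => //; exact/measurable_EFinP.
rewrite !mule1 lee_fin ler_wpM2l// ler_nat.
by have := @le_above l tau x; case: above => // ->//; rewrite ltau leqnn.
Qed.

Lemma level_int1_le1 l : level_int l (fun=> 1) <= 1.
Proof.
rewrite -[leRHS]f1; apply: le_iint => [|x||x].
- by apply: emeasurable_funM => //; exact/measurable_EFinP.
- by rewrite mule1 lee_fin.
- exact/measurable_EFinP.
by rewrite mule1 lee_fin ler_piMr// lern1 leq_b1.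
Qed.

(** Both sides are integral-like in h and agree on indicators by stationarity, hence they agree on
    all nonnegative measurable functions. *)
Lemma level_int_stationary l (h : E -> \bar R) : (l <= tau)%N ->
  measurable_fun [set: E] h -> (forall x, 0 <= h x) ->
  level_int l (fun x => \int[kappa l x]_y h y) = level_int l h.
Proof.
move=> ltau; apply: (functional_unique
    (kernel_functional (kappa l) (level_int_functional l)) (level_int_functional l)) => A mA.
(* [Zl] is the [fine] of an extended integral, so its positivity requires that integral to be finite
   as well as positive. It is needed to cancel the normalisation in [qdens]. *)
have Z_gt0 : (0 < Zl f S g l)%R.
  rewrite /Zl -lte_fin fineK.
    by have := level_int1_gt0 ltau; rewrite /level_int; under eq_fun do rewrite mule1.
  rewrite ge0_fin_numE; last by apply: iint_ge0 => x; rewrite lee_fin.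
  apply: (@le_lt_trans _ _ 1); last exact: ltry.
  by have := level_int1_le1 l; rewrite /level_int; under eq_fun do rewrite mule1.
have mq : measurable_fun [set: E] (qdens f S g l).
  exact: measurable_funM.
have q0 x : (0 <= qdens f S g l x)%R by rewrite divr_ge0// ltW.
have levelE (h' : E -> \bar R) : measurable_fun [set: E] h' -> (forall x, 0 <= h' x) ->
    level_int l h' = (Zl f S g l)%:E * iint (fun x => (qdens f S g l x)%:E * h' x).
  move=> mh h0; rewrite -iintZl ?(ltW Z_gt0)//; first last.
  - by move=> x; apply: mule_ge0; rewrite ?lee_fin.
  - by apply: emeasurable_funM => //; exact/measurable_EFinP.
  congr iint; apply/funext => x; rewrite muleA; congr (_ * _).
  by rewrite -EFinM /qdens; congr EFin; rewrite [RHS]mulrC mulfVK// gt_eqF.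
rewrite (_ : (fun x => \int[kappa l x]_y (EFin \o \1_A) y) = fun x => kappa l x A); last first.
  apply/funext => x; transitivity (\int[kappa l x]_y (\1_A y)%:E) => //.
  by rewrite integral_indic// setIT.
rewrite !levelE//; first last.
- exact: measurable_kernel.
- by move=> x; rewrite lee_fin.
- exact/measurable_EFinP.
by rewrite (kappa_st ltau mA).
Qed.

(** Started from the weight of level l, each of the j states has that same weight by stationarity,
    and the survival test cuts it down to the weight of level l + 1. Expectations add, so the
    dependence between the states is harmless. *)
Lemma level_int_survivors l j (h : E -> \bar R) : (l < tau)%N ->
  measurable_fun [set: E] h -> (forall x, 0 <= h x) ->
  level_int l (survivors l j h) = j%:R%:E * level_int l.+1 h.
Proof.
move=> ltau mh h0; have HI := level_int_functional l.
have next : level_int l (fun z => if above l.+1 z then h z else 0) = level_int l.+1 h.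
  congr iint; apply/funext => x; case: ifPn => [a|_].
    by rewrite (@le_above l l.+1 x)// leqnSn.
  by rewrite mule0 mulr0 mul0e.
elim: j => [|j IHj] /=; first by rewrite mul0e; exact: functional0.
have m1 := measurable_if_above g mS l.+1 mh.
have m2 := measurable_survivors g kappa mS l j mh h0.
rewrite level_int_stationary ?(ltnW ltau)//; first last.
- by move=> x; apply: adde_ge0; [case: ifP|exact: survivors_ge0].
- exact: emeasurable_funD.
rewrite (functionalD HI)//; first last.
- exact: survivors_ge0.
- by move=> x; case: ifP.
rewrite next IHj -[X in X + _]mul1e -ge0_muleDl ?lee_fin//.
by rewrite -EFinD -mulrS.
Qed.

Lemma level_int_descendants k l (h : E -> \bar R) : (l + k <= tau)%N ->
  measurable_fun [set: E] h -> (forall x, 0 <= h x) ->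
  level_int l (descendants k l h) = (s ^ k)%:R%:E * level_int (l + k) h.
Proof.
move=> + mh h0; elim: k l => [|k IHk] l lk; first by rewrite addn0 mul1e.
rewrite /= level_int_survivors; first last.
- exact: descendants_ge0.
- exact: measurable_descendants.
- by apply: leq_trans lk; rewrite addnS ltnS leq_addr.
by rewrite IHk addSnnS// muleA -EFinM -natrM expnS.
Qed.

Definition trial_fun (K : seq E -> \bar R) (y : E) : \bar R :=
  (f y)%:E * (if above 1 y then run (tau - 1) 1 [:: y] K else K [::]).

Lemma trial_fun_ge0 K : (forall ys, 0 <= K ys) -> forall y, 0 <= trial_fun K y.
Proof.
move=> K0 y; apply: mule_ge0; first by rewrite lee_fin.
by case: ifP => // _; exact: run_ge0.
Qed.

Lemma measurable_trial_fun K : ge0_measurable K ->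
  measurable_fun [set: E] (trial_fun K).
Proof.
move=> gK; apply: emeasurable_funM; first exact/measurable_EFinP.
have mr := (ge0_measurable_run g s kappa mS (tau - 1) 1 gK).1 1%N.
apply: (measurable_fun_ifT (measurable_above g mS 1)
  (g := fun y => run (tau - 1) 1 [:: y] K) (h := fun=> K [::])) => //.
apply: (measurableT_comp mr (g := fun y => cons_tuple y [tuple])).
exact: measurable_cons.
Qed.

Lemma trialD K1 K2 : ge0_measurable K1 -> ge0_measurable K2 ->
  trialE (fun ys => K1 ys + K2 ys) = trialE K1 + trialE K2.
Proof.
move=> g1 g2; rewrite -iintD;
  try by [exact: measurable_trial_fun|apply: trial_fun_ge0; case: g1; case: g2].
congr iint; apply/funext => y; rewrite -ge0_muleDr.
- by case: ifP => // _; rewrite runD.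
- by case: ifP => _; [apply: run_ge0|]; case: g1.
- by case: ifP => _; [apply: run_ge0|]; case: g2.
Qed.

Lemma trialZl (c : R) K : ge0_measurable K -> (0 <= c)%R ->
  trialE (fun ys => c%:E * K ys) = c%:E * trialE K.
Proof.
move=> gK c0; rewrite -iintZl//;
  try by [exact: measurable_trial_fun|apply: trial_fun_ge0; case: gK].
congr iint; apply/funext => y; rewrite muleCA; congr (_ * _).
by case: ifP => // _; rewrite runZl.
Qed.

Lemma trial_ge0 K : (forall ys, 0 <= K ys) -> 0 <= trialE K.
Proof. by move=> K0; apply: iint_ge0; exact: trial_fun_ge0. Qed.

Lemma eq_trial K1 K2 : (forall ys, (size ys <= s ^ (tau - 1))%N -> K1 ys = K2 ys) ->
  trialE K1 = trialE K2.
Proof.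
move=> K12; congr iint; apply/funext => y; case: ifP => _; last by rewrite K12.
by congr (_ * _); apply: eq_run => ys; rewrite muln1; exact: K12.
Qed.

Lemma trial1 : trialE (fun=> 1) = 1.
Proof.
rewrite -[RHS]f1; congr iint; apply/funext => y.
by rewrite run_cst; case: ifP => _; rewrite mule1.
Qed.

(** The test on the initial draw turns f into the weight of level 1, and each of the tau - 1 stages
    then contributes a factor s. A rejected draw gives an empty sum. *)
Lemma trial_sum (h : E -> \bar R) : measurable_fun [set: E] h -> (forall x, 0 <= h x) ->
  trialE (fun ys => \sum_(x <- ys) h x) =
  (s ^ (tau - 1))%:R%:E * level_int tau h.
Proof.
move=> mh h0; rewrite -[X in level_int X h](subnKC tau_gt0).
rewrite -level_int_descendants ?subnKC//.
congr iint; apply/funext => y; case: ifP => _.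
  by rewrite run_sum// big_cons big_nil adde0 mulr1.
by rewrite big_nil mulr0 mul0e mule0.
Qed.

Lemma ge0_measurable_sum (J : Type) (r : seq J) (K : J -> seq E -> \bar R) :
  (forall j, ge0_measurable (K j)) -> ge0_measurable (fun ys => \sum_(j <- r) K j ys).
Proof.
move=> gK; split => [n|ys]; last by apply: sume_ge0 => j _; exact: (gK j).2.
by apply: emeasurable_sum => j; exact: (gK j).1.
Qed.

Lemma trial_bigsum (J : Type) (r : seq J) (K : J -> seq E -> \bar R) :
  (forall j, ge0_measurable (K j)) ->
  trialE (fun ys => \sum_(j <- r) K j ys) = \sum_(j <- r) trialE (K j).
Proof.
move=> gK; elim: r => [|j r IHr].
  under eq_trial do rewrite big_nil.
  rewrite big_nil -[RHS](functional0 (level_int_functional 1)).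
  congr iint; apply/funext => y; rewrite run_cst.
  by case: ifP; rewrite !mule0.
under eq_trial do rewrite big_cons.
by rewrite trialD ?IHr ?big_cons//; exact: ge0_measurable_sum.
Qed.

(** * Reduction to the finite law of the size and the count *)

Section statistics.
Variable A : set E.
Hypothesis mA : measurable A.
Local Notation N := (s ^ (tau - 1))%N.

Lemma measurable_Hcount n :
  measurable_fun [set: n.-tuple E] (fun ys : n.-tuple E => Hcount A ys).
Proof.
elim: n => [|n IHn].
  rewrite (_ : (fun _ => _) = fun=> 0%N); first exact: measurable_cst.
  by apply/funext => ys; rewrite (tuple0 ys).
rewrite (_ : (fun _ => _) = fun ys : n.+1.-tuple E =>
    (nat_of_bool `[<A (thead ys)>] + Hcount A [tuple of behead ys])%N); last first.
  by apply/funext => ys; case/tupleP: ys => x ys; rewrite theadE.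
apply: measurable_fun_addn.
  apply: (measurableT_comp (f := nat_of_bool)); first by move=> _ ? _; exact: I.
  apply: (measurable_fun_bool true).
  rewrite (_ : _ @^-1` _ = (fun ys => tnth ys ord0) @^-1` A).
    by apply: measurable_tnth.
  by apply/seteqP; split => ys /= /asboolP.
apply: (measurableT_comp IHn); exact: measurable_behead.
Qed.

Lemma ge0_measurable_stat (phi : nat -> nat -> R) : (forall a b, (0 <= phi a b)%R) ->
  ge0_measurable (fun ys => (phi (size ys) (Hcount A ys))%:E).
Proof.
move=> phi0; split => [n|ys]; last by rewrite lee_fin.
rewrite (_ : (fun _ => _) = (fun b => (phi n b)%:E) \o
    (fun ys : n.-tuple E => Hcount A ys)); last first.
  by apply/funext => ys /=; rewrite size_tuple.
by apply: measurableT_comp; [move=> _ ? _; exact: I|exact: measurable_Hcount].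
Qed.

(** The possible values of (M, H(A)) for a non-empty trial. The constraints 1 <= M and H <= M are
    part of the type because the ratio estimates require them at every point. *)
Definition outcome :=
  {w : 'I_N.+1 * 'I_N.+1 | (0 < w.1)%N && (w.2 <= w.1)%N}.

Definition omega_stat (w : outcome) : nat * nat := (nat_of_ord (val w).1, nat_of_ord (val w).2).

Let indic_outcome (w : outcome) (ys : seq E) : R :=
  ((size ys == (omega_stat w).1) && (Hcount A ys == (omega_stat w).2))%:R.

Let ge0_measurable_indic w : ge0_measurable (fun ys => (indic_outcome w ys)%:E).
Proof.
exact: (ge0_measurable_stat (phi := fun a b =>
  ((a == (omega_stat w).1) && (b == (omega_stat w).2))%:R%R)).
Qed.

Let prob_outcome (w : outcome) : R :=
  fine (trialE (fun ys => (indic_outcome w ys)%:E)).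

Let prob_outcomeE w : trialE (fun ys => (indic_outcome w ys)%:E) = (prob_outcome w)%:E.
Proof.
rewrite fineK// ge0_fin_numE; last by apply: trial_ge0 => ys; rewrite lee_fin.
apply: (@le_lt_trans _ _ 1); last exact: ltry.
(* Finiteness comes from additivity: the indicator and its complement are nonnegative and their
   expectations add up to 1. *)
have gC : ge0_measurable (fun ys => (1 - indic_outcome w ys)%:E).
  apply: (ge0_measurable_stat (phi := fun a b =>
    1 - ((a == (omega_stat w).1) && (b == (omega_stat w).2))%:R)%R) => a b.
  by rewrite subr_ge0 lern1 leq_b1.
rewrite -trial1 (_ : (fun=> 1) = fun ys =>
    (indic_outcome w ys)%:E + (1 - indic_outcome w ys)%:E); last first.
  by apply/funext => ys; rewrite -EFinD addrC subrK.
by rewrite trialD// leeDl// trial_ge0//; case: gC.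
Qed.

Let prob_outcome_ge0 w : (0 <= prob_outcome w)%R.
Proof. by apply/fine_ge0/trial_ge0 => ys; rewrite lee_fin. Qed.

(** The integrand is a finite combination of indicators of outcomes. The empty list belongs to no
    outcome, in agreement with the value 0 that [neE] assigns to it. *)
Lemma trial_stat (phi : nat -> nat -> R) : (forall a b, (0 <= phi a b)%R) ->
  trialE (fun ys => if ys is [::] then 0 else (phi (size ys) (Hcount A ys))%:E) =
  (\sum_w prob_outcome w * phi (omega_stat w).1 (omega_stat w).2)%R%:E.
Proof.
move=> phi0.
transitivity (trialE (fun ys => \sum_(w : outcome)
    (phi (omega_stat w).1 (omega_stat w).2)%:E * (indic_outcome w ys)%:E)).
  apply: eq_trial => ys ysN.
  have [ys0|ys_gt0] := posnP (size ys).
    rewrite (size0nil ys0) big1// => w _; rewrite /indic_outcome /=.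
    by case: w => -[[[|a] ?] b] //= _; rewrite mule0.
  have -> : (if ys is [::] then 0 else (phi (size ys) (Hcount A ys))%:E) =
      (phi (size ys) (Hcount A ys))%:E by case: ys ys_gt0 {ysN}.
  have H_le : (Hcount A ys <= size ys)%N by exact: count_size.
  have H_N : (Hcount A ys < N.+1)%N by rewrite ltnS (leq_trans H_le).
  have w0P : (0 < (Ordinal (ysN : (size ys < N.+1)%N), Ordinal H_N).1)%N &&
      ((Ordinal (ysN : (size ys < N.+1)%N), Ordinal H_N).2 <=
       (Ordinal (ysN : (size ys < N.+1)%N), Ordinal H_N).1)%N.
    by rewrite /= ys_gt0.
  pose w0 : outcome := exist _ (Ordinal (ysN : (size ys < N.+1)%N), Ordinal H_N) w0P.
  rewrite (bigD1 w0)//= big1 ?adde0.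
    by rewrite /indic_outcome /= !eqxx mule1.
  move=> w ww0; rewrite /indic_outcome; case: andP => [[/eqP e1 /eqP e2]|]; last by rewrite mule0.
  case/eqP: ww0; apply/val_inj => /=.
  by case: w e1 e2 => -[a b] /= _ e1 e2; congr (_, _); apply/val_inj.
rewrite trial_bigsum; last first.
  move=> w; apply: (ge0_measurable_stat (phi := fun a b =>
    phi (omega_stat w).1 (omega_stat w).2 *
    ((a == (omega_stat w).1) && (b == (omega_stat w).2))%:R)%R) => a b.
  by rewrite mulr_ge0.
rewrite -sumEFin; apply: eq_bigr => w _.
by rewrite trialZl// prob_outcomeE -EFinM mulrC.
Qed.

(** The probability that a trial is non-empty. *)
Let D : R := \sum_w prob_outcome w.

Definition law (w : outcome) : R := (prob_outcome w / D)%R.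

Lemma trial_size : (\sum_w prob_outcome w * (omega_stat w).1%:R)%R%:E =
  N%:R%:E * level_int tau (fun=> 1).
Proof.
rewrite -trial_sum// -(trial_stat (phi := fun a _ => a%:R%R))//.
apply: eq_trial => ys _.
rewrite sumEFin big_const_seq count_predT iter_addr_0.
by case: ys.
Qed.

Lemma trial_Hcount : (\sum_w prob_outcome w * (omega_stat w).2%:R)%R%:E =
  N%:R%:E * level_int tau (EFin \o \1_A).
Proof.
rewrite -trial_sum//; first last.
- by move=> x; rewrite lee_fin.
- exact/measurable_EFinP.
rewrite -(trial_stat (phi := fun _ b => b%:R%R))//.
apply: eq_trial => ys _; rewrite sumEFin.
transitivity ((Hcount A ys)%:R%:E : \bar R); first by case: ys.
congr EFin; elim: ys => [|y ys IHys]; first by rewrite big_nil.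
by rewrite big_cons -IHys /Hcount /= natrD indicE.
Qed.

Let N_gt0 : (0 < N)%N.
Proof. by rewrite expn_gt0 (leq_trans _ s_ge2). Qed.

(** If every outcome had probability 0, so would the expected size of a trial vanish; but that is
    [s ^ (tau - 1)] times the positive probability of reaching the last level. *)
Lemma nonempty_gt0 : (0 < D)%R.
Proof.
rewrite lt_neqAle sumr_ge0// andbT eq_sym; apply/eqP => D0.
have p0 w : prob_outcome w = 0%R.
  by apply/eqP; move/eqP: D0; rewrite psumr_eq0// => /allP/(_ w (mem_index_enum _)).
have := trial_size; rewrite big1; last by move=> w _; rewrite p0 mul0r.
move=> /esym/eqP; rewrite gt_eqF//; apply: mule_gt0; last exact: level_int1_gt0.
by rewrite lte_fin ltr0n.
Qed.

Lemma law_ge0 w : (0 <= law w)%R.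
Proof. by rewrite divr_ge0// ltW// nonempty_gt0. Qed.

Lemma law_sum1 : (\sum_w law w)%R = 1%R.
Proof. by rewrite -mulr_suml divff// gt_eqF// nonempty_gt0. Qed.

Lemma neE_stat (phi : nat -> nat -> R) : (forall a b, (0 <= phi a b)%R) ->
  neE (fun Y => (phi (size Y) (Hcount A Y))%:E) =
  fexp law (fun w => phi (omega_stat w).1 (omega_stat w).2).
Proof.
move=> phi0; rewrite /Defs.neE trial_stat//.
rewrite (trial_stat (phi := fun _ _ => 1%R))//=.
under [X in (_ / X)%R]eq_bigr do rewrite mulr1.
rewrite -/D /fexp mulr_suml; apply: eq_bigr => w _.
by rewrite /law mulrAC.
Qed.

Let stat (Y : seq E) : nat * nat := (size Y, Hcount A Y).

(** The induction hypothesis turns the expectation over the later trials into a function of the size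
    and count of the current one, the only kind of integrand that [neE_stat] has to handle. *)
Lemma multiE_stat n (Phi : seq (nat * nat) -> R) : (forall ws, (0 <= Phi ws)%R) ->
  multiE f S g s tau kappa n (fun Ys => (Phi (map stat Ys))%:E) =
  iidexp law n (fun ws => Phi (map omega_stat ws)).
Proof.
elim: n Phi => [//|n IHn] Phi Phi0 /=.
rewrite -(neE_stat (phi := fun a b => iidexp law n (fun ws => Phi ((a, b) :: map omega_stat ws)))).
  by congr neE; apply/funext => Y; rewrite (IHn (fun ws => Phi (stat Y :: ws))).
move=> a b; apply: (expectation_ge0 (iidexp_expectation law_ge0 law_sum1 n)) => ws.
exact: Phi0.
Qed.

Local Notation M := (fun w => (omega_stat w).1%:R : R).
Local Notation H := (fun w => (omega_stat w).2%:R : R).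
Local Notation q := (Qtarget f S gam A).

(** [law] depends on A, but the left-hand side does not; this makes the resulting bounds uniform in
    A. *)
Lemma momM_law k : momM f S g s tau kappa k = fexp law (fun w => M w ^+ k)%R.
Proof. by apply: (neE_stat (phi := fun a _ => a%:R ^+ k)%R) => a _; rewrite exprn_ge0. Qed.

Lemma mM_law : mM f S g s tau kappa = fexp law M.
Proof. exact: (momM_law 1). Qed.

Let QtargetE : q = (fine (level_int tau (EFin \o \1_A)) / fine (level_int tau (fun=> 1%E)))%R.
Proof.
rewrite level_int1_tau; congr (fine _ / _)%R.
congr iint; apply/funext => x; rewrite above_tauE -EFinM /= !indicE in_setI.
rewrite -mulrA -natrM mulnb andbC; congr (_ * (nat_of_bool (_ && _))%:R)%:E.
by apply/idP/idP; rewrite inE.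
Qed.

Let level_int_indic_le : level_int tau (EFin \o \1_A) <= level_int tau (fun=> 1).
Proof.
apply: le_iint => [|x||x].
- by apply: emeasurable_funM => //; exact/measurable_EFinP.
- by apply: mule_ge0; rewrite lee_fin.
- by apply: emeasurable_funM => //; exact/measurable_EFinP.
by rewrite lee_wpmul2l ?lee_fin// indicE lern1 leq_b1.
Qed.

Let level_int_indic_ge0 : 0 <= level_int tau (EFin \o \1_A).
Proof. by apply: iint_ge0 => x; apply: mule_ge0; rewrite lee_fin. Qed.

Let fin1 : level_int tau (fun=> 1) \is a fin_num.
Proof.
rewrite ge0_fin_numE; last exact/ltW/level_int1_gt0.
exact: le_lt_trans (level_int1_le1 tau) (ltry _).
Qed.

Let finA : level_int tau (EFin \o \1_A) \is a fin_num.
Proof.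
rewrite ge0_fin_numE//; apply: le_lt_trans level_int_indic_le _.
by rewrite -ge0_fin_numE// ltW// level_int1_gt0.
Qed.

Let fine1_gt0 : (0 < fine (level_int tau (fun=> 1%E)))%R.
Proof. by rewrite -lte_fin fineK// level_int1_gt0. Qed.

Lemma Qtarget_ge0 : (0 <= q)%R.
Proof. by rewrite QtargetE divr_ge0 ?(ltW fine1_gt0)// fine_ge0. Qed.

Lemma Qtarget_le1 : (q <= 1)%R.
Proof. by rewrite QtargetE ler_pdivrMr// mul1r fine_le. Qed.

(** Conditioning on non-emptiness divides both expectations by the same probability, since empty
    trials contribute 0 to either count; the factor [s ^ (tau - 1)] is common too. *)
Lemma law_unbiased : fexp law H = (q * fexp law M)%R.
Proof.
have lawE (X : outcome -> R) : fexp law X = ((\sum_w prob_outcome w * X w) / D)%R.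
  by rewrite /fexp mulr_suml; apply: eq_bigr => w _; rewrite /law mulrAC.
rewrite !lawE mulrA; congr (_ / _)%R.
have eM := trial_size; have eH := trial_Hcount.
rewrite -(fineK fin1) -EFinM in eM; rewrite -(fineK finA) -EFinM in eH.
case: eM => ->; case: eH => ->.
by rewrite QtargetE mulrCA mulfVK// gt_eqF.
Qed.

Let M_ge1 w : (1 <= M w)%R.
Proof. by case: w => w /= /andP[w0 _]; rewrite ler1n. Qed.

Let H_le_M w : (H w <= M w)%R.
Proof. by case: w => w /= /andP[_ w2]; rewrite ler_nat. Qed.

Let ratio (ws : seq (nat * nat)) : R :=
  ((\sum_(w <- ws) w.2)%:R / (\sum_(w <- ws) w.1)%:R)%R.

Let ratio_ge0 ws : (0 <= ratio ws)%R.
Proof. by rewrite divr_ge0. Qed.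

Let Qhat_ratio (Ys : seq (seq E)) : Qhat Ys A = ratio (map stat Ys).
Proof. by rewrite /Qhat /ratio !big_map. Qed.

Let ratio_law ws : ratio (map omega_stat ws) =
  ((\sum_(w <- ws) H w) / (\sum_(w <- ws) M w))%R.
Proof. by rewrite /ratio !big_map !natr_sum. Qed.

Lemma Qn_law n : Qn f S g s tau kappa n A =
  iidexp law n (fun ws => (\sum_(w <- ws) H w) / (\sum_(w <- ws) M w))%R.
Proof.
rewrite /Qn; under eq_fun do rewrite Qhat_ratio.
rewrite multiE_stat//; congr iidexp.
by apply/funext => ws; exact: ratio_law.
Qed.

Lemma L1_law n :
  multiE f S g s tau kappa n (fun Ys => (`|Qhat Ys A - q|)%:E) =
  iidexp law n (fun ws => `|(\sum_(w <- ws) H w) / (\sum_(w <- ws) M w) - q|)%R.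
Proof.
under eq_fun do rewrite Qhat_ratio.
rewrite (multiE_stat n (Phi := fun ws => `|ratio ws - q|%R))//.
by congr iidexp; apply/funext => ws; rewrite ratio_law.
Qed.

Lemma Qn_bias n : (0 < n)%N ->
  let m := mM f S g s tau kappa in
  let V := VarM f S g s tau kappa in
  (`|Qn f S g s tau kappa n A - q| <=
   (V + Num.sqrt (V * momM f S g s tau kappa 2)) / m ^+ 2 / n%:R)%R.
Proof.
move=> n_gt0 /=; rewrite Qn_law /VarM mM_law momM_law.
apply: ratio_bias => //.
- exact: law_ge0.
- exact: law_sum1.
- exact: Qtarget_ge0.
- exact: Qtarget_le1.
- exact: law_unbiased.
Qed.

Lemma Qhat_L1 n : (0 < n)%N ->
  (multiE f S g s tau kappa n (fun Ys => (`|Qhat Ys A - q|)%:E) <=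
   (Num.sqrt (momM f S g s tau kappa 2)
    + Num.sqrt (3 * momM f S g s tau kappa 4 / n%:R)) / mM f S g s tau kappa
   / Num.sqrt n%:R)%R.
Proof.
move=> n_gt0; rewrite L1_law mM_law !momM_law.
apply: ratio_L1 => //.
- exact: law_ge0.
- exact: law_sum1.
- exact: Qtarget_ge0.
- exact: Qtarget_le1.
- exact: law_unbiased.
Qed.

Lemma mM_gt0 : (0 < mM f S g s tau kappa)%R.
Proof.
have HE := fexp_expectation law_ge0 law_sum1.
rewrite mM_law; apply: (@lt_le_trans _ _ 1%R) => //.
by rewrite -[leLHS](expectation1 HE); apply: (expectation_le HE) => w; exact: M_ge1.
Qed.

Lemma momM_ge0 k : (0 <= momM f S g s tau kappa k)%R.
Proof.
rewrite momM_law; apply: (expectation_ge0 (fexp_expectation law_ge0 law_sum1)) => w.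
by rewrite exprn_ge0.
Qed.

End statistics.

End splitting.

Unset Implicit Arguments.

Theorem theorem1 (R : realType) (d : nat) (f S : d.-tuple R -> R) (gam : R)
  (s tau : nat) (g : nat -> \bar R) (kappa : nat -> R.-pker d.-tuple R ~> d.-tuple R) :
  measurable_fun [set: d.-tuple R] f -> (forall x, 0 <= f x) ->
  iint (fun x => (f x)%:E) = 1%E ->
  measurable_fun [set: d.-tuple R] S ->
  (0 < iint (fun x => (f x * \1_[set y | gam <= S y] x)%:E))%E ->
  (2 <= s)%N -> (1 <= tau)%N ->
  g 0%N = -oo%E ->
  (forall l, (0 < l <= tau)%N -> g l \is a fin_num) ->
  (forall l, (l < tau)%N -> (g l < g l.+1)%E) ->
  g tau = gam%:E ->
  (forall l, (l <= tau)%N -> stationary f S g kappa l) ->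
  forall n : nat, (1 <= n)%N ->
  let m := mM f S g s tau kappa in
  let V := VarM f S g s tau kappa in
  let EM2 := momM f S g s tau kappa 2 in
  let EM4 := momM f S g s tau kappa 4 in
  let c1 := (V + Num.sqrt (V * EM2)) / m ^+ 2 in
  let c1t := fun k : nat => (Num.sqrt EM2 + Num.sqrt (3 * EM4 / k%:R)) / m in
  (forall A : set (d.-tuple R), measurable A ->
     `|Qn f S g s tau kappa n A - Qtarget f S gam A| <= c1 / n%:R) /\
  (forall A : set (d.-tuple R), measurable A ->
     multiE f S g s tau kappa n
       (fun Ys => (`|Qhat Ys A - Qtarget f S gam A|)%:E)
     <= c1t n / Num.sqrt n%:R) /\
  (exists C : R, forall k : nat, (1 <= k)%N -> c1t k <= C).
Proof.
move=> mf f0 f1 mS pos s2 tau1 _ _ glt gtau st n n1 m V EM2 EM4 c1 c1t.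
split; last split.
- by move=> A mA; apply: (Qn_bias mf f0 f1 mS pos s2 tau1 glt gtau st mA n1).
- by move=> A mA; apply: (Qhat_L1 mf f0 f1 mS pos s2 tau1 glt gtau st mA n1).
(* Since k occurs only in a denominator under the root, [c1t] is nonincreasing and its value at 1 is
   a uniform bound. *)
- exists (c1t 1%N) => k k1; rewrite /c1t.
  (* Moments of M do not involve a set, so the finite law is taken for A equal to the whole
     space. *)
  have m_gt0 : 0 < m := mM_gt0 mf f0 f1 mS pos s2 tau1 glt gtau st measurableT.
  have EM4_ge0 : 0 <= EM4 := momM_ge0 mf f0 f1 mS pos s2 tau1 glt gtau st measurableT 4.
  rewrite ler_pM2r ?invr_gt0// lerD2l ler_wsqrtr// ler_wpM2l ?(mulr_ge0 _ EM4_ge0)//.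
  by rewrite lef_pV2 ?posrE ?ltr0n// ler_nat.
Qed.
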